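(* Let $n$ be a large natural number and consider the $(1:E_b)$-biased games on $K_n$, where $E_b$ denotes a matching of size $b$. Then: (1) the threshold bias for the triangle game $\mathcal{F}_{K_3}(E_b,n)$ is $b=\Theta(n)$; (2) the threshold bias for the connectivity game $\mathcal{C}(E_b,n)$ is $b=\Theta(n)$; (3) the threshold bias for the Hamiltonicity game $\mathcal{H}(E_b,n)$ is $b=\Theta(n)$.
   Context: Structure-biased Maker-Breaker game on $K_n$: the board is the edge set of $K_n$; Maker and Breaker alternate turns; on each turn Maker claims one unclaimed edge, while Breaker claims a set of unclaimed edges forming a subgraph of a copy of a given graph $H$. For the $(1:E_b)$ bias, on each turn Breaker claims a set of at most $b$ pairwise disjoint (vertex-disjoint) unclaimed edges. The game ends when no unclaimed edges remain. In $\mathcal{F}_{K_3}$ Maker wins if her graph contains a triangle; in $\mathcal{C}$ Maker wins if her graph contains a spanning tree of $K_n$; in $\mathcal{H}$ Maker wins if her graph contains a Hamiltonian path of $K_n$; otherwise Breaker wins. The threshold bias is the value $b_0(n)$ such that Breaker wins if $b>b_0$ and Maker wins if $b\le b_0$. Convention: when considering Maker strategies Breaker makes the first move, and when considering Breaker strategies Maker makes the first move. *)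

(* Defs.v *)
From mathcomp Require Import all_boot.

Set Implicit Arguments.
Unset Strict Implicit.
Unset Printing Implicit Defensive.

(* A graph on the vertex set 'I_n is a set of edges, an edge being a
   two-element set of vertices. *)
Notation graph n := {set {set 'I_n}}.

Definition board (n : nat) : graph n := [set e : {set 'I_n} | #|e| == 2].

Definition adj n (G : graph n) : rel 'I_n :=
  [rel u v | (u != v) && ([set u; v] \in G)].

Definition has_triangle n (G : graph n) : Prop :=
  exists u v w : 'I_n, [/\ adj G u v, adj G v w & adj G u w].

Definition spanning_tree n (T : graph n) : Prop :=
  (forall u v : 'I_n, connect (adj T) u v) /\
  (forall c : seq 'I_n, 2 < size c -> ~ ucycle (adj T) c).

Definition has_spanning_tree n (G : graph n) : Prop :=
  exists2 T : graph n, T \subset G & spanning_tree T.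

Definition has_hamiltonian_path n (G : graph n) : Prop :=
  exists p : seq 'I_n, [/\ uniq p, (forall v, v \in p) & sorted (adj G) p].

Inductive player := Maker | Breaker.

Definition opponent (pl : player) : player :=
  if pl is Maker then Breaker else Maker.

Record position n := Position { maker_graph : graph n; breaker_graph : graph n }.

Definition start n : position n := Position set0 set0.

Definition unclaimed n (p : position n) : graph n :=
  board n :\: (maker_graph p :|: breaker_graph p).

(* Strategies are positional: a player's choice depends on the edges claimed so
   far by each side.  No position occurs twice with the same player to move
   before the end of the game, so dependence on the history adds nothing. *)
Definition maker_strategy n := position n -> {set 'I_n}.
Definition breaker_strategy n := position n -> graph n.

Definition maker_legal n (s : maker_strategy n) : Prop :=
  forall p, unclaimed p != set0 -> s p \in unclaimed p.

(* trivIset: the claimed edges are pairwise vertex-disjoint. *)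
Definition breaker_legal n (b : nat) (t : breaker_strategy n) : Prop :=
  forall p, [/\ t p \subset unclaimed p, #|t p| <= b & trivIset (t p)].

Definition turn n (s : maker_strategy n) (t : breaker_strategy n)
    (pl : player) (p : position n) : position n :=
  if unclaimed p == set0 then p else
  match pl with
  | Maker => Position (s p |: maker_graph p) (breaker_graph p)
  | Breaker => Position (maker_graph p) (t p :|: breaker_graph p)
  end.

(* The position after k turns, pl making the first one. *)
Fixpoint play n (s : maker_strategy n) (t : breaker_strategy n)
    (pl : player) (k : nat) (p : position n) : position n :=
  if k is k'.+1 then play s t (opponent pl) k' (turn s t pl p) else p.

(* The graph Maker owns when no unclaimed edge remains is G. *)
Definition final_maker_graph n (s : maker_strategy n) (t : breaker_strategy n)
    (first : player) (G : graph n) : Prop :=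
  exists k, unclaimed (play s t first k (start n)) = set0 /\
            maker_graph (play s t first k (start n)) = G.

Definition maker_wins n (goal : graph n -> Prop) (first : player) (b : nat) :
    Prop :=
  exists2 s : maker_strategy n, maker_legal s &
  forall t : breaker_strategy n, breaker_legal b t ->
  exists2 G, final_maker_graph s t first G & goal G.

Definition breaker_wins n (goal : graph n -> Prop) (first : player) (b : nat) :
    Prop :=
  exists2 t : breaker_strategy n, breaker_legal b t &
  forall s : maker_strategy n, maker_legal s ->
  exists2 G, final_maker_graph s t first G & ~ goal G.

(* A matching of size b lies in K_n only when b <= n./2, so the bias b and its
   threshold b0 range over 0, ..., n./2. *)
Definition is_threshold_bias n (goal : graph n -> Prop) (first : player)
    (b0 : nat) : Prop :=
  b0 <= n./2 /\
  forall b, b <= n./2 ->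
    (b0 < b -> breaker_wins goal first b) /\
    (b <= b0 -> maker_wins goal first b).

(* Main.v *)
Require Import Defs.
From mathcomp Require Import all_boot zify boolp.

(**
The game is finite, hence determined, and the set of biases with which Maker
wins is closed downwards; so the threshold is the largest such bias, and it is
at most [n./2]. It remains to let Maker win with a linear bias. Breaker's edges
form a matching, so of two threats sharing a vertex he can only parry one.

Triangle: Maker claims edges [va1], [va2], [va3] with [a1a3], [a2a3] free;
Breaker cannot parry both threats at [a3].

Hamiltonian path (hence spanning tree): Maker grows a path by absorbing, in two
moves, the outside vertex [u] with the most Breaker edges. While the path is
short, with ends [x] and [y], she picks a fresh [z] with [uz], [xz], [yz] free,
claims [uz], and then [xz] or [yz]. Once the path is long, [u] has free edges to
three consecutive vertices [x], [y], [z] of the path; she claims [uy], and then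
[ux] or [uz], inserting [u] next to [y]. Breaker owns few edges in all, so few
vertices ever have large Breaker degree; serving the worst vertex first keeps
the degree of every outside vertex small.
*)

Set Implicit Arguments.
Unset Strict Implicit.
Unset Printing Implicit Defensive.

Lemma card_gt_sum (T : finType) (A : {pred T}) (f : T -> nat) k :
  #|[set x in A | k < f x]| * k.+1 <= \sum_(x in A) f x.
Proof.
rewrite -sum_nat_cond_const big_mkcondr /=.
by apply: leq_sum => x _; case: ifP.
Qed.

Section HypergraphDegree.

Variable T : finType.

Implicit Types (A e : {set T}) (B D M : {set {set T}}) (s : seq T).
Implicit Types (u v w x z : T).

Lemma set2_inj v : injective (fun w => [set v; w]).
Proof.
move=> w w' /setP eq_vw; have := eq_vw w; rewrite !inE eqxx orbT.
case/esym/orP=> /eqP // w_v; have := eq_vw w'.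
by rewrite !inE eqxx orbT w_v orbb => /eqP.
Qed.

Lemma cover_setU1 M e : cover (e |: M) = e :|: cover M.
Proof. by rewrite /cover bigcup_setU big_set1. Qed.

Lemma notin_cover M z x : z \notin cover M -> [set z; x] \notin M.
Proof.
by apply: contra => zxM; apply/bigcupP; exists [set z; x]; rewrite ?set21.
Qed.

Definition deg B v := #|[set e in B | v \in e]|.

Lemma deg0 v : deg set0 v = 0.
Proof. by rewrite /deg setIdE set0I cards0. Qed.

Lemma deg_sub B B' v : B \subset B' -> deg B v <= deg B' v.
Proof. by move=> sBB'; rewrite /deg !setIdE subset_leq_card ?setSI. Qed.

Lemma deg_setU B D v : deg (B :|: D) v <= deg B v + deg D v.
Proof. by rewrite /deg !setIdE setIUl cardsU leq_subr. Qed.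

Lemma deg_trivIset D v : trivIset D -> deg D v <= 1.
Proof.
move=> tD; apply/card_le1_eqP => e e'.
rewrite !inE => /andP[eD ve] /andP[e'D ve'].
by rewrite -(def_pblock tD eD ve) (def_pblock tD e'D ve').
Qed.

Lemma trivIset_set2 D v w w' : trivIset D -> w != w' ->
  [set v; w] \notin D \/ [set v; w'] \notin D.
Proof.
move=> tD ww'; have [vwD|] := boolP ([set v; w] \in D); [right|by left].
apply: contra ww' => vw'D; apply/eqP/(@set2_inj v).
by rewrite -(def_pblock tD vwD (set21 v w)) (def_pblock tD vw'D (set21 v w')).
Qed.

Lemma sum_deg B : \sum_v deg B v = \sum_(e in B) #|e|.
Proof.
under eq_bigr do rewrite /deg -sum1dep_card.
rewrite (exchange_big_dep (mem B)) /=; last by move=> v e _ /andP[].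
by apply: eq_bigr => e eB; rewrite -sum1_card; apply: eq_bigl => v; rewrite eB.
Qed.

Definition nbrs B v := [set w | [set v; w] \in B].

Lemma card_nbrs B v : #|nbrs B v| <= deg B v.
Proof.
rewrite -(card_imset _ (@set2_inj v)); apply/subset_leq_card/subsetP => e.
by case/imsetP=> w; rewrite !inE => vwB ->; rewrite vwB set21.
Qed.

Lemma count_nbrs B v s :
  uniq s -> count (fun w => [set v; w] \in B) s <= deg B v.
Proof.
move=> Us; rewrite -size_filter -(card_uniqP (filter_uniq _ Us)).
apply: leq_trans (card_nbrs B v); apply/subset_leq_card/subsetP => w.
by rewrite mem_filter inE => /andP[].
Qed.

Lemma exists_free_vertex B A s :
  #|A| + \sum_(x <- s) deg B x < #|T| ->
  exists2 z, z \notin A & all (fun x => [set z; x] \notin B) s.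
Proof.
elim: s A => [|x s IHs] A.
  rewrite big_nil addn0 -(cardsC A) -[ltnLHS]addn0 ltn_add2l.
  by case/card_gt0P=> z; rewrite inE; exists z.
rewrite big_cons addnA => lt_T; have [|z] := IHs (A :|: nbrs B x).
  apply: leq_ltn_trans lt_T; rewrite leq_add2r.
  apply: leq_trans (leq_of_leqif (leq_card_setU _ _)) _.
  by rewrite leq_add2l card_nbrs.
rewrite !inE negb_or => /andP[zA xzB] free_z.
by exists z; rewrite //= setUC xzB.
Qed.

End HypergraphDegree.

Section Determinacy.

Variables (n b : nat) (goal : graph n -> Prop).

Implicit Types (p : position n) (pl : player) (D M B : graph n).
Implicit Types (e : {set 'I_n}).

Definition breaker_move p D :=
  [/\ D \subset unclaimed p, #|D| <= b & trivIset D].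

Definition after_maker p e := Position (e |: maker_graph p) (breaker_graph p).

Definition after_breaker p D :=
  Position (maker_graph p) (D :|: breaker_graph p).

Inductive winning : player -> position n -> Prop :=
| WinningEnd pl p : unclaimed p = set0 -> goal (maker_graph p) -> winning pl p
| WinningMaker p e : e \in unclaimed p -> winning Breaker (after_maker p e) ->
    winning Maker p
| WinningBreaker p : unclaimed p != set0 ->
    (forall D, breaker_move p D -> winning Maker (after_breaker p D)) ->
    winning Breaker p.

Lemma goal_of_winning_end pl p :
  winning pl p -> unclaimed p = set0 -> goal (maker_graph p).
Proof.
by case=> // {}p => [e eU _ U0|/eqP U_neq0 _ /U_neq0 //]; rewrite U0 inE in eU.
Qed.

Lemma exists_winning_move p : winning Maker p -> unclaimed p != set0 ->
  exists2 e, e \in unclaimed p & winning Breaker (after_maker p e).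
Proof.
move=> w U_neq0; inversion_clear w as [? ? U0|? e eU we|]; last by exists e.
by rewrite U0 eqxx in U_neq0.
Qed.

Lemma winning_after_reply p D : winning Breaker p -> unclaimed p != set0 ->
  breaker_move p D -> winning Maker (after_breaker p D).
Proof.
move=> w U_neq0; inversion_clear w as [? ? U0| |? _ wD]; last exact: wD.
by rewrite U0 eqxx in U_neq0.
Qed.

Lemma breaker_move0 p : breaker_move p set0.
Proof.
by split; rewrite ?sub0set ?cards0 //; apply/trivIsetP => A B; rewrite inE.
Qed.

Lemma card_unclaimed_after_maker p e :
  e \in unclaimed p -> #|unclaimed (after_maker p e)| < #|unclaimed p|.
Proof.
move=> eU; apply/proper_card/properP; split; first exact/setDS/setSU/subsetU1.
by exists e => //; rewrite !inE eqxx.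
Qed.

Lemma card_unclaimed_after_breaker p D :
  #|unclaimed (after_breaker p D)| <= #|unclaimed p|.
Proof. exact/subset_leq_card/setDS/setUS/subsetUr. Qed.

Lemma game_ind (Q : player -> position n -> Prop) :
  (forall pl p, unclaimed p = set0 -> Q pl p) ->
  (forall p, unclaimed p != set0 ->
     (forall e, e \in unclaimed p -> Q Breaker (after_maker p e)) ->
     Q Maker p) ->
  (forall p, unclaimed p != set0 ->
     (forall D, Q Maker (after_breaker p D)) -> Q Breaker p) ->
  forall pl p, Q pl p.
Proof.
move=> Q_end Q_maker Q_breaker pl p.
pose rank pl p := 2 * #|unclaimed p| + (if pl is Maker then 0 else 1).
have [k] := ubnP (rank pl p).
elim: k pl p => // k IHk pl p; rewrite ltnS => rank_p.
have [U0|U_neq0] := eqVneq (unclaimed p) set0; first exact: Q_end.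
case: pl rank_p => rank_p.
  apply: Q_maker => // e eU; apply: IHk.
  by have := card_unclaimed_after_maker eU; rewrite /rank in rank_p *; lia.
apply: Q_breaker => // D; apply: IHk.
by have := card_unclaimed_after_breaker p D; rewrite /rank in rank_p *; lia.
Qed.

Lemma winning_of_goal : (forall M M', M \subset M' -> goal M -> goal M') ->
  forall pl p, goal (maker_graph p) -> winning pl p.
Proof.
move=> goalS; apply: game_ind => [pl p U0|p U_neq0 IHp|p U_neq0 IHp] goal_p.
- exact: WinningEnd.
- have /set0Pn[e eU] := U_neq0; apply: (WinningMaker eU); apply: IHp => //.
  exact/goalS/goal_p/subsetUr.
- by apply: WinningBreaker => // D _; apply: IHp.
Qed.

Lemma play_invariant s t (Inv : player -> position n -> Prop) :
  maker_legal s ->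
  (forall p, unclaimed p != set0 -> Inv Maker p ->
     Inv Breaker (after_maker p (s p))) ->
  (forall p, unclaimed p != set0 -> Inv Breaker p ->
     Inv Maker (after_breaker p (t p))) ->
  forall pl p, Inv pl p ->
  exists k, unclaimed (play s t pl k p) = set0 /\
            exists pl', Inv pl' (play s t pl k p).
Proof.
move=> legal_s Inv_s Inv_t.
apply: game_ind => [pl p U0|p U_neq0 IHp|p U_neq0 IHp] Inv_p.
- by exists 0; split=> //; exists pl.
- have [k end_k] := IHp _ (legal_s p U_neq0) (Inv_s p U_neq0 Inv_p).
  by exists k.+1; rewrite /= /turn (negPf U_neq0).
- have [k end_k] := IHp _ (Inv_t p U_neq0 Inv_p).
  by exists k.+1; rewrite /= /turn (negPf U_neq0).
Qed.

Lemma maker_wins_of_winning first :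
  winning first (start n) -> maker_wins goal first b.
Proof.
move=> w0.
have /choice[s s_wins] p : exists e, unclaimed p != set0 ->
    e \in unclaimed p /\ (winning Maker p -> winning Breaker (after_maker p e)).
  have [U0|U_neq0] := eqVneq (unclaimed p) set0; first by exists set0.
  have [w|not_w] := pselect (winning Maker p).
    by have [e eU we] := exists_winning_move w U_neq0; exists e.
  by have /set0Pn[e eU] := U_neq0; exists e.
have legal_s : maker_legal s by move=> p /s_wins[].
exists s => // t legal_t.
have [||k [Uk0 [pl wk]]] := play_invariant (t := t) legal_s _ _ w0.
- by move=> p /s_wins[].
- by move=> p U_neq0 /winning_after_reply; apply.
exists (maker_graph (play s t first k (start n))); first by exists k.
exact: goal_of_winning_end wk Uk0.
Qed.

Lemma breaker_wins_of_not_winning first :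
  ~ winning first (start n) -> breaker_wins goal first b.
Proof.
move=> not_w0.
have /choice[t t_wins] p : exists D, breaker_move p D /\
    (unclaimed p != set0 -> ~ winning Breaker p ->
     ~ winning Maker (after_breaker p D)).
  have [[D]|no_D] := pselect (exists2 D, breaker_move p D &
      ~ winning Maker (after_breaker p D)); first by exists D.
  exists set0; split=> [|U_neq0 []]; first exact: breaker_move0.
  apply: WinningBreaker => // D move_D; apply: contrapT => not_wD.
  by apply: no_D; exists D.
have legal_t : breaker_legal b t by move=> p; have [] := t_wins p.
exists t => // s legal_s.
have [||k [Uk0 [pl not_wk]]] := play_invariant (t := t)
  (Inv := fun pl p => ~ winning pl p) legal_s _ _ not_w0.
- by move=> p U_neq0 not_w w; apply/not_w/(WinningMaker (legal_s p U_neq0)).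
- by move=> p; have [_] := t_wins p; apply.
exists (maker_graph (play s t first k (start n))); first by exists k.
by move=> goal_k; apply/not_wk/WinningEnd.
Qed.

End Determinacy.

Lemma breaker_wins_of_not_maker_wins n (goal : graph n -> Prop) first b :
  ~ maker_wins goal first b -> breaker_wins goal first b.
Proof.
move=> not_wins.
by apply: breaker_wins_of_not_winning => /maker_wins_of_winning.
Qed.

Lemma maker_wins_leq n (goal : graph n -> Prop) first b b' :
  b <= b' -> maker_wins goal first b' -> maker_wins goal first b.
Proof.
move=> le_bb' [s legal_s s_wins]; exists s => // t legal_t; apply: s_wins => p.
by have [? tp_le ?] := legal_t p; split=> //; apply: leq_trans tp_le le_bb'.
Qed.

Lemma maker_wins_imply n (goal goal' : graph n -> Prop) first b :
  (forall G, goal G -> goal' G) -> maker_wins goal first b ->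
  maker_wins goal' first b.
Proof.
move=> sub_goal [s legal_s s_wins]; exists s => // t /s_wins[G final_G goal_G].
by exists G => //; apply: sub_goal.
Qed.

Definition threshold n (goal : graph n -> Prop) first :=
  \max_(b < n./2.+1 | `[< maker_wins goal first b >]) b.

Lemma threshold_leq n (goal : graph n -> Prop) first :
  threshold goal first <= n./2.
Proof. by apply/bigmax_leqP => b _; rewrite -ltnS. Qed.

Lemma leq_threshold n (goal : graph n -> Prop) first b :
  b <= n./2 -> maker_wins goal first b -> b <= threshold goal first.
Proof.
rewrite -ltnS => lt_b /asboolP wins_b.
exact: (@leq_bigmax_cond _ _ _ (Ordinal lt_b)).
Qed.

Lemma maker_wins_threshold n (goal : graph n -> Prop) first :
  maker_wins goal first 0 -> maker_wins goal first (threshold goal first).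
Proof.
move=> /asboolP wins0.
have [|b /asboolP wins_b max_b] := @eq_bigmax_cond _
    [pred b : 'I_n./2.+1 | `[< maker_wins goal first b >]] val.
  by apply/card_gt0P; exists ord0.
by rewrite /threshold (eq_bigl _ _ (fun=> erefl)) max_b.
Qed.

Lemma is_threshold_bias_threshold n (goal : graph n -> Prop) first :
  maker_wins goal first 0 ->
  is_threshold_bias goal first (threshold goal first).
Proof.
move=> wins0; split=> [|b le_b]; first exact: threshold_leq.
split=> [lt_b|/maker_wins_leq]; last by apply; apply: maker_wins_threshold.
apply: breaker_wins_of_not_maker_wins => /(leq_threshold le_b).
by rewrite leqNgt lt_b.
Qed.

Section Adjacency.

Variable n : nat.

Implicit Types (M : graph n) (u v : 'I_n).

Lemma adj_sym M : symmetric (adj M).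
Proof. by move=> u v; rewrite /adj /= eq_sym setUC. Qed.

Lemma adj_sub M M' : M \subset M' -> subrel (adj M) (adj M').
Proof. by move=> /subsetP sub u v /andP[uv /sub uvM']; apply/andP. Qed.

Lemma adj_setU1 M u v : u != v -> adj ([set u; v] |: M) u v.
Proof. by move=> uv; rewrite /adj /= uv setU11. Qed.

Lemma has_triangle_sub M M' : M \subset M' -> has_triangle M -> has_triangle M'.
Proof.
by move=> /adj_sub sub [u [v [w [/sub ? /sub ? /sub ?]]]]; exists u, v, w.
Qed.

Lemma has_hamiltonian_path_sub M M' :
  M \subset M' -> has_hamiltonian_path M -> has_hamiltonian_path M'.
Proof.
by move=> /adj_sub sub [p [Up all_p /(sub_sorted sub) sorted_p]]; exists p.
Qed.

End Adjacency.

Section Rounds.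

Variables (n b : nat) (goal : graph n -> Prop).

Implicit Types (M B D : graph n) (A e : {set 'I_n}) (a c u v w : 'I_n).

Local Notation winning := (winning b goal).

Lemma unclaimed_set2 M B u v :
  ([set u; v] \in unclaimed (Position M B)) =
  [&& u != v, [set u; v] \notin M & [set u; v] \notin B].
Proof. by rewrite !inE cards2 negb_or /= andbC; case: (u != v). Qed.

(* Only what survives the composition of [k] replies of Breaker; that a reply is
   a matching matters only within its round. *)
Definition replies k B B' :=
  [/\ B \subset B', B' \subset B :|: board n, #|B'| <= #|B| + k * b &
      forall v, deg B' v <= deg B v + k].

Lemma replies_trans k l B1 B2 B3 :
  replies k B1 B2 -> replies l B2 B3 -> replies (k + l) B1 B3.
Proof.
move=> [sub12 new12 card12 deg12] [sub23 new23 card23 deg23]; split.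
- exact: subset_trans sub23.
- by apply: subset_trans new23 _; rewrite subUset new12 subsetUr.
- by rewrite mulnDl addnA; apply: leq_trans card23 _; rewrite leq_add2r.
- by move=> v; rewrite addnA; apply: leq_trans (deg23 v) _; rewrite leq_add2r.
Qed.

Lemma replies1 D B :
  D \subset board n -> #|D| <= b -> trivIset D -> replies 1 B (D :|: B).
Proof.
move=> sub_D card_D triv_D; split; rewrite ?subsetUr //.
- by rewrite setUC setUS.
- rewrite setUC mul1n; apply: leq_trans (leq_of_leqif (leq_card_setU _ _)) _.
  by rewrite leq_add2l.
- move=> v; rewrite setUC; apply: leq_trans (deg_setU _ _ _) _.
  by rewrite leq_add2l deg_trivIset.
Qed.

Lemma winning_breaker_turn M B :
  (forall D, trivIset D -> replies 1 B (D :|: B) ->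
     winning Maker (Position M (D :|: B))) ->
  winning Breaker (Position M B).
Proof.
move=> w_replies; set p := Position M B.
have w_move D : breaker_move b p D -> winning Maker (after_breaker p D).
  case=> sub_D card_D triv_D; apply/w_replies/replies1 => //.
  exact/(subset_trans sub_D)/subsetDl.
have [U0|U_neq0] := eqVneq (unclaimed p) set0; last exact: WinningBreaker.
apply: WinningEnd => //; have := w_move _ (breaker_move0 b p).
by rewrite /after_breaker set0U => /goal_of_winning_end; apply.
Qed.

Lemma winning_maker_turn M B e : e \in unclaimed (Position M B) ->
  (forall D, trivIset D -> replies 1 B (D :|: B) ->
     winning Maker (Position (e |: M) (D :|: B))) ->
  winning Maker (Position M B).
Proof. by move=> eU w; apply: WinningMaker eU (winning_breaker_turn w). Qed.

Lemma winning_start first :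
  (forall B, replies 1 set0 B -> winning Maker (Position set0 B)) ->
  winning first (start n).
Proof.
move=> w_replies; case: first; last first.
  by apply: winning_breaker_turn => D _; apply: w_replies.
apply: w_replies; rewrite -[X in replies _ _ X]setU0; apply: replies1.
- exact: sub0set.
- by rewrite cards0.
- by apply/trivIsetP => e e'; rewrite inE.
Qed.

Lemma winning_fresh_edge M B A c :
  cover M \subset A -> c \in A -> #|A| + deg B c < n ->
  (forall w B', w \notin A -> replies 1 B B' ->
     winning Maker (Position ([set w; c] |: M) B')) ->
  winning Maker (Position M B).
Proof.
move=> cover_M cA lt_n w_replies.
have [|w wA] := @exists_free_vertex _ B A [:: c].
  by rewrite card_ord big_seq1.
rewrite /= andbT => wcB.
apply: (@winning_maker_turn _ _ [set w; c]) => [|D _]; last exact: w_replies.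
have wc : w != c by apply: contraNneq wA => ->.
have wM : w \notin cover M by apply: contra wA; apply/subsetP.
by rewrite unclaimed_set2 wc wcB notin_cover.
Qed.

Lemma winning_double_threat M B w c a1 a2 :
  w \notin cover M -> uniq [:: w; c; a1; a2] ->
  all (fun x => [set w; x] \notin B) [:: c; a1; a2] ->
  (forall a B', a \in [:: a1; a2] -> replies 2 B B' ->
     winning Maker (Position ([set w; a] |: ([set w; c] |: M)) B')) ->
  winning Maker (Position M B).
Proof.
rewrite /= !inE !negb_or !andbT => wM /and3P[/and3P[wc wa1 wa2]].
case/andP=> ca1 ca2 a12 /and3P[wcB wa1B wa2B] w_replies.
apply: (@winning_maker_turn _ _ [set w; c]) => [|D triv_D reply_D].
  by rewrite unclaimed_set2 wc notin_cover.
have claim a : a \in [:: a1; a2] -> w != a -> c != a -> [set w; a] \notin B ->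
    [set w; a] \notin D -> winning Maker (Position ([set w; c] |: M) (D :|: B)).
  move=> a_in wa ca waB waD.
  apply: (@winning_maker_turn _ _ [set w; a]) => [|D' _ reply_D'].
    rewrite unclaimed_set2 wa !in_setU1 !inE !negb_or notin_cover // waB waD.
    by rewrite (inj_eq (@set2_inj _ w)) eq_sym ca.
  exact: w_replies (replies_trans reply_D reply_D').
have [waD|waD] := trivIset_set2 w triv_D a12.
  by apply: (claim a1); rewrite ?inE ?eqxx.
by apply: (claim a2); rewrite ?inE ?eqxx ?orbT.
Qed.

End Rounds.

Section TriangleGame.

Variables (n b : nat).

Implicit Types (M B : graph n) (a v w : 'I_n).

Local Notation winning := (winning b (@has_triangle n)).

Lemma winning_cherry M B v a1 a2 :
  adj M v a1 -> adj M v a2 -> a1 != a2 -> cover M \subset [set v; a1; a2] ->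
  3 + (deg B v + (deg B a1 + deg B a2)) < n ->
  winning Maker (Position M B).
Proof.
move=> va1 va2 a12 cover_M lt_n.
have [|w] := @exists_free_vertex _ B [set v; a1; a2] [:: v; a1; a2].
  rewrite card_ord !big_cons big_nil addn0; apply: leq_ltn_trans lt_n.
  rewrite leq_add2r setUC cardsU1 cards2.
  by case: (_ \notin _); case: (_ != _).
move=> w_new w_free.
have wM : w \notin cover M by apply: contra w_new; apply/subsetP.
move: w_new; rewrite !inE !negb_or => /andP[/andP[wv wa1] wa2].
have distinct : uniq [:: w; v; a1; a2].
  have /andP[v_a1 _] := va1; have /andP[v_a2 _] := va2.
  by rewrite /= !inE !negb_or wv wa1 wa2 v_a1 v_a2 a12.
apply: (winning_double_threat wM distinct w_free) => a B' a_in _.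
apply: winning_of_goal; first exact: has_triangle_sub.
have [va wa] : adj M v a /\ w != a.
  by move: a_in; rewrite !inE => /orP[]/eqP->.
exists v, w, a; split.
- by rewrite adj_sym; apply: adj_sub (adj_setU1 _ wv); apply: subsetUr.
- exact: adj_setU1.
- by apply: adj_sub va; rewrite setUA subsetUr.
Qed.

Lemma maker_wins_triangle first :
  12 < n -> maker_wins (@has_triangle n) first b.
Proof.
move=> n_gt12; apply/maker_wins_of_winning/winning_start => B0 [_ _ _ deg_B0].
have n_gt0 : 0 < n by apply: leq_trans n_gt12.
pose v := Ordinal n_gt0.
apply: (winning_fresh_edge (A := [set v]) (c := v)) => [|||a1 B1 a1v].
- by rewrite /cover big_set0 sub0set.
- exact: set11.
- by have := deg_B0 v; rewrite deg0 cards1; lia.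
case=> _ _ _ deg_B1; rewrite inE in a1v.
apply: (winning_fresh_edge (A := [set a1; v]) (c := v)) => [|||a2 B2 a2_new].
- by rewrite setU0 cover1.
- exact: set22.
- by have := deg_B0 v; have := deg_B1 v; rewrite deg0 cards2 a1v; lia.
case=> _ _ _ deg_B2; move: a2_new; rewrite !inE negb_or => /andP[a2a1 a2v].
have deg_B2_le w : deg B2 w <= 3.
  by have := deg_B0 w; have := deg_B1 w; have := deg_B2 w; rewrite deg0; lia.
apply: (@winning_cherry _ _ v a2 a1) => //.
- by rewrite adj_sym adj_setU1.
- by rewrite adj_sym; apply: adj_sub (adj_setU1 _ a1v); apply: subsetUr.
- by rewrite setU0 cover_setU1 cover1 !subUset !sub1set !inE !eqxx !orbT.
- by have := deg_B2_le v; have := deg_B2_le a1; have := deg_B2_le a2; lia.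
Qed.

End TriangleGame.

Lemma three_consecutive (T : Type) (a : pred T) (s : seq T) :
  3 * (count a s).+1 <= size s ->
  exists s1 x y z s2,
    s = s1 ++ [:: x; y; z] ++ s2 /\ all (predC a) [:: x; y; z].
Proof.
have [k] := ubnP (size s); elim: k s => // k IHk [|x [|y [|z s]]] //=; try lia.
move=> lt_k le_size; have [xyz|xyz] := boolP (all (predC a) [:: x; y; z]).
  by exists [::], x, y, z, s.
have [||s1 [x' [y' [z' [s2 [-> xyz']]]]]] := IHk s; [by lia| |].
  by move: xyz le_size => /=; do 3![case: (a _)] => //= _; lia.
by exists [:: x, y, z & s1], x', y', z', s2.
Qed.

Lemma sorted_insert (T : Type) (e : rel T) s1 x u y s2 :
  sorted e (s1 ++ [:: x, y & s2]) -> e x u -> e u y ->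
  sorted e (s1 ++ [:: x, u, y & s2]).
Proof.
move=> + xu uy; case: s1 => [|w s1]; rewrite /= ?cat_path /= xu uy.
  by case/andP.
by case/and4P=> -> -> _ ->.
Qed.

Section PathAbsorption.

Variables (n b thr : nat).

Implicit Types (P : seq 'I_n) (M B : graph n) (a c u v w x y z : 'I_n).

Local Notation winning := (winning b (@has_hamiltonian_path n)).

Definition heavy P B := #|[set v in P | thr < deg B v]|.

(* [path_deg_out] survives the absorption of the outside vertex of maximal
   degree: two rounds add at most 2 to every degree, and either that vertex
   becomes a new heavy vertex of the path, or all outside degrees were at most
   [thr]. *)
Record path_state P M B : Prop := PathState {
  path_uniq : uniq P;
  path_sorted : sorted (adj M) P;
  path_cover : {subset cover M <= P};
  path_size : 1 < size P;
  path_board : B \subset board n;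
  path_card : #|B| <= 2 * size P * b;
  path_deg : forall v, deg B v <= 2 * size P;
  path_deg_out : forall v, v \notin P -> deg B v <= thr + 2 * heavy P B + 2 }.

Lemma heavy_leq P B : B \subset board n -> heavy P B * thr.+1 <= 2 * #|B|.
Proof.
move=> sub_B; apply: leq_trans (card_gt_sum _ _ _) _.
have -> : 2 * #|B| = \sum_v deg B v.
  rewrite sum_deg mulnC -sum_nat_const; apply: eq_bigr => e /(subsetP sub_B).
  by rewrite inE => /eqP.
by rewrite [leqRHS](bigID (mem P)) leq_addr.
Qed.

Lemma heavy_absorb P P' B B' u :
  u \notin P -> {subset u :: P <= P'} -> B \subset B' -> thr < deg B u ->
  heavy P B < heavy P' B'.
Proof.
move=> uP subP subB heavy_u; apply/proper_card/properP; split.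
  apply/subsetP=> v; rewrite !inE => /andP[vP heavy_v].
  by rewrite subP ?inE ?vP ?orbT //; apply: leq_trans heavy_v (deg_sub v subB).
exists u; rewrite inE ?(negPf uP) // subP ?mem_head //.
exact: leq_trans heavy_u (deg_sub u subB).
Qed.

Lemma path_state_absorb P M B u P' M' B' :
  path_state P M B -> u \notin P ->
  (forall v, v \notin P -> deg B v <= deg B u) -> replies b 2 B B' ->
  {subset u :: P <= P'} -> uniq P' -> sorted (adj M') P' ->
  {subset cover M' <= P'} -> path_state P' M' B'.
Proof.
move=> [UP _ _ sizeP boardB cardB degB outB] uP max_u.
case=> [subB newB' cardB' degB'] subP UP' sortedP' coverM'.
have ltP : size P < size P'.
  by apply: (@uniq_leq_size _ (u :: P)); rewrite //= uP.
split=> //.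
- exact: ltn_trans ltP.
- by apply: subset_trans newB' _; rewrite subUset boardB subxx.
- apply: leq_trans cardB' _; apply: (@leq_trans (2 * (size P).+1 * b)).
    by rewrite mulnS mulnDl addnC leq_add2l.
  by rewrite leq_mul2r leq_mul2l ltP !orbT.
- move=> v; apply: leq_trans (degB' v) _.
  by have := degB v; lia.
move=> v vP'; have vP : v \notin P.
  by apply: contra vP' => vP; rewrite subP // inE vP orbT.
apply: leq_trans (degB' v) _; rewrite leq_add2r.
have [heavy_u|light_u] := ltnP thr (deg B u).
  have := heavy_absorb uP subP subB heavy_u; have := outB v vP; lia.
exact: leq_trans (max_u v vP) (leq_trans light_u (leq_addr _ _)).
Qed.

Variables (P : seq 'I_n) (M B : graph n) (u : 'I_n).

Hypothesis state_P : path_state P M B.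
Hypothesis uP : u \notin P.
Hypothesis max_u : forall v, v \notin P -> deg B v <= deg B u.
Hypothesis winning_longer : forall P' M' B',
  size P < size P' -> path_state P' M' B' -> winning Maker (Position M' B').

Lemma winning_absorb s w c a1 a2 :
  uniq (s ++ P) -> u \in s -> w \notin P ->
  {subset [:: w; c; a1; a2] <= s ++ P} -> uniq [:: w; c; a1; a2] ->
  all (fun x => [set w; x] \notin B) [:: c; a1; a2] ->
  (forall a (e : rel 'I_n), a \in [:: a1; a2] -> symmetric e ->
     e w c -> e w a -> sorted e P ->
     exists2 P', perm_eq P' (s ++ P) & sorted e P') ->
  winning Maker (Position M B).
Proof.
move=> UsP us wP sub_ends distinct free_w new_path.
have wM : w \notin cover M by apply: contra wP; apply: (path_cover state_P).
have w_neq v : v \in [:: c; a1; a2] -> w != v.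
  by apply: contraTneq => <-; move: distinct => /= /andP[].
apply: (winning_double_threat wM distinct free_w) => a B' a_in reply_B'.
set M' := _ |: _.
have [||||P' perm_P' sorted_P'] := new_path a (adj M') a_in.
- exact: adj_sym.
- have wc := w_neq c (mem_head _ _).
  by apply: adj_sub (adj_setU1 _ wc); apply: subsetUr.
- by apply/adj_setU1/w_neq; rewrite in_cons a_in orbT.
- apply: sub_sorted (path_sorted state_P); apply: adj_sub.
  by rewrite /M' setUA subsetUr.
have mem_P' : P' =i s ++ P := perm_mem perm_P'.
apply: (winning_longer (P' := P')).
  rewrite (perm_size perm_P') size_cat -[ltnLHS]add0n ltn_add2r.
  by case: (s) us.
apply: (path_state_absorb state_P uP max_u reply_B') => //.
- move=> v; rewrite inE mem_P' mem_cat => /predU1P[->|->]; first by rewrite us.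
  by rewrite orbT.
- by rewrite (perm_uniq perm_P').
move=> v; rewrite !cover_setU1 !inE mem_P'.
case/or3P=> [/orP[]/eqP->|/orP[]/eqP->|/(path_cover state_P) vP].
- by rewrite sub_ends ?mem_head.
- by rewrite sub_ends // 2!in_cons a_in !orbT.
- by rewrite sub_ends ?mem_head.
- by rewrite sub_ends // !inE eqxx orbT.
- by rewrite mem_cat vP orbT.
Qed.

Lemma winning_extend : 7 * size P + 1 < n -> winning Maker (Position M B).
Proof.
have [UP _ _ sizeP _ _ degP _] := state_P.
case defP: P sizeP => [|x [|q P2]] // _; set y := last q P2.
rewrite -defP => short.
have [|z] := @exists_free_vertex _ B [set v in u :: P] [:: u; x; y].
  rewrite card_ord cardsE !big_cons big_nil.
  apply: leq_ltn_trans (leq_add (card_size (u :: P)) (leqnn _)) _ => /=.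
  by have := degP u; have := degP x; have := degP y; lia.
rewrite inE in_cons negb_or => /andP[zu zP] free_z.
have ends : subseq [:: z; u; x; y] ([:: z; u] ++ P).
  rewrite defP; apply: (cat_subseq (subseq_refl [:: z; u; x])).
  by rewrite sub1seq mem_last.
have UzuP : uniq ([:: z; u] ++ P) by rewrite /= inE negb_or zu zP uP.
have distinct := subseq_uniq ends UzuP.
apply: (winning_absorb UzuP _ zP (mem_subseq ends) distinct free_z).
  by rewrite !inE eqxx orbT.
move=> a e a_in sym_e zu_e za_e sorted_e; move: a_in za_e.
rewrite !inE => /orP[]/eqP-> e_z.
  exists [:: u, z & P]; first by rewrite (perm_catCA [:: u] [:: z]).
  by rewrite defP /= in sorted_e *; rewrite sym_e zu_e e_z.
exists (P ++ [:: z; u]); first by rewrite perm_catC.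
move: sorted_e; rewrite defP /= cat_path => /andP[-> ->] /=.
by rewrite -/y sym_e e_z zu_e.
Qed.

Lemma winning_insert :
  3 * (deg B u).+1 <= size P -> winning Maker (Position M B).
Proof.
have UP := path_uniq state_P => long.
have [|s1 [x [y [z [s2 [defP]]]]]] :=
  @three_consecutive _ (fun v => [set u; v] \in B) P.
  by apply: leq_trans long; rewrite leq_mul2l ltnS count_nbrs ?orbT.
rewrite /= andbT => /and3P[free_x free_y free_z].
have Uu : uniq ([:: u] ++ P) by rewrite /= uP.
have ends : subseq [:: u; x; y; z] ([:: u] ++ P).
  rewrite defP; apply: (cat_subseq (subseq_refl [:: u])).
  exact: subseq_trans (prefix_subseq _ s2) (suffix_subseq s1 _).
have perm_ends : perm_eq [:: u; y; x; z] [:: u; x; y; z].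
  by rewrite perm_cons (perm_catCA [:: y] [:: x]).
apply: (@winning_absorb [:: u] u y x z) => //; rewrite ?mem_head //.
- by move=> v; rewrite (perm_mem perm_ends) => /(mem_subseq ends).
- by rewrite (perm_uniq perm_ends) (subseq_uniq ends).
- by rewrite /= free_x free_y free_z.
move=> a e a_in sym_e uy_e ua_e; rewrite defP; move: a_in ua_e.
rewrite !inE => /orP[]/eqP-> e_u sorted_e.
  exists (s1 ++ [:: x, u, y, z & s2]).
    by rewrite -cat_rcons (perm_catCA _ [:: u]) /= cat_rcons.
  by apply: sorted_insert; rewrite // sym_e.
exists (rcons s1 x ++ [:: y, u, z & s2]).
  by rewrite -cat_rcons (perm_catCA _ [:: u]) /= !cat_rcons.
by apply: sorted_insert; rewrite ?cat_rcons // sym_e.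
Qed.

End PathAbsorption.

Section HamiltonicityGame.

Variables (n b : nat).

Hypothesis n_ge : 300 <= n.
Hypothesis b_le : 4000 * b <= n.

Local Notation winning := (winning b (@has_hamiltonian_path n)).

Let thr := n %/ 50.

(* Each heavy vertex is on more than [n/50] of the at most [2 * size P * b]
   edges of Breaker, so that at most a twentieth of the path is heavy. *)
Lemma path_deg_out_long (P : seq 'I_n) (M B : graph n) u :
  path_state b thr P M B -> u \notin P -> n <= 7 * size P + 1 ->
  3 * (deg B u).+1 <= size P.
Proof.
move=> state_P uP long.
have heavy_edges : heavy thr P B * thr.+1 <= 4 * size P * b.
  apply: leq_trans (heavy_leq _ _ (path_board state_P)) _.
  by have := path_card state_P; lia.
have heavy_le : 20 * heavy thr P B <= size P.
  rewrite -(@leq_pmul2r n); last by lia.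
  apply: (@leq_trans (1000 * (heavy thr P B * thr.+1))).
    have n_le : n <= 50 * thr.+1 by rewrite /thr; lia.
    by nia.
  apply: (@leq_trans (size P * (4000 * b))); first by lia.
  by rewrite leq_mul2l b_le orbT.
by have := path_deg_out state_P uP; rewrite /thr in heavy_le *; lia.
Qed.

Lemma winning_path_state P M B :
  path_state b thr P M B -> winning Maker (Position M B).
Proof.
have [k] := ubnP (n - size P); elim: k P M B => // k IHk P M B lt_k state_P.
have [/forallP all_P|/forallPn[v vP]] := boolP [forall v, v \in P].
  apply: winning_of_goal; first exact: has_hamiltonian_path_sub.
  by exists P; split; [exact: path_uniq state_P| |exact: path_sorted state_P].
case: (@arg_maxnP _ v [pred v | v \notin P] (deg B) vP) => u /= uP max_u.
have winning_longer P' M' B' : size P < size P' -> path_state b thr P' M' B' ->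
    winning Maker (Position M' B').
  move=> ltP state_P'; apply: (IHk P') => //.
  have size_P' : size P' <= n.
    by rewrite -(card_uniqP (path_uniq state_P')) -[leqRHS]card_ord max_card.
  lia.
have [short|long] := ltnP (7 * size P + 1) n.
  exact: winning_extend state_P uP max_u winning_longer short.
apply: (winning_insert state_P uP max_u winning_longer).
exact: path_deg_out_long state_P uP long.
Qed.

Lemma maker_wins_hamiltonian_path first :
  maker_wins (@has_hamiltonian_path n) first b.
Proof.
apply/maker_wins_of_winning/winning_start => B0 [_ board_B0 card_B0 deg_B0].
have n_gt0 : 0 < n by apply: leq_trans n_ge.
pose x := Ordinal n_gt0.
apply: (winning_fresh_edge (A := [set x]) (c := x)) => [|||y B1 yx].
- by rewrite /cover big_set0 sub0set.
- exact: set11.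
- by have := deg_B0 x; rewrite deg0 cards1; lia.
case=> _ board_B1 card_B1 deg_B1; rewrite inE in yx.
have deg_B1_le v : deg B1 v <= 2.
  by have := deg_B0 v; have := deg_B1 v; rewrite deg0; lia.
apply: (@winning_path_state [:: y; x]); split=> //=.
- by rewrite inE yx.
- by rewrite adj_setU1.
- by move=> v; rewrite setU0 cover1 !inE.
- rewrite set0U in board_B0; apply: subset_trans board_B1 _.
  by rewrite subUset board_B0 subxx.
- by apply: leq_trans card_B1 _; rewrite cards0 in card_B0; lia.
- by move=> v; apply: leq_trans (deg_B1_le v) _.
- by move=> v _; apply: leq_trans (deg_B1_le v) _; rewrite leq_addl.
Qed.

End HamiltonicityGame.

Lemma connect_sorted (T : finType) (e : rel T) s :
  connect_sym e -> sorted e s -> {in s &, forall u v, connect e u v}.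
Proof.
case: s => [//|x s] sym_e sorted_s u v /(path_connect sorted_s).
by rewrite sym_e => ux /(path_connect sorted_s); apply: connect_trans.
Qed.

(* On a longer cycle, the two neighbours of the vertex of largest rank would
   have the same rank. *)
Lemma ucycle_ranked (T : finType) (e : rel T) (rank : T -> nat) c :
  {in c &, injective rank} ->
  (forall u v, e u v -> rank v = (rank u).+1 \/ rank u = (rank v).+1) ->
  ucycle e c -> size c <= 2.
Proof.
move=> rank_inj rank_e; case: c rank_inj => // x0 c0; set c := x0 :: c0.
move=> rank_inj /andP[cycle_c uniq_c]; rewrite leqNgt; apply/negP => size_c.
have [x xc max_x] := @arg_maxnP _ x0 (mem c) rank (mem_head x0 c0).
have [i s def_c] := rot_to xc.
have mem_s v : v \in s -> v \in c.
  by move=> vs; rewrite -(mem_rot i) def_c inE vs orbT.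
move: cycle_c uniq_c size_c.
rewrite -(rot_cycle i) -(rot_uniq i) -(size_rot i) def_c.
case: s mem_s {def_c} => [//|y s]; case/lastP: s => [//|s z] mem_s.
rewrite /= rcons_path last_rcons => /and3P[xy _ zx] /and3P[_ yz _] _.
have [yc zc] : y \in c /\ z \in c.
  by split; apply: mem_s; rewrite !inE ?mem_rcons ?inE ?eqxx ?orbT.
have eq_rank : rank y = rank z.
  have := max_x y yc; have := max_x z zc.
  by case: (rank_e _ _ xy); case: (rank_e _ _ zx); lia.
by rewrite (rank_inj _ _ yc zc eq_rank) mem_rcons mem_head in yz.
Qed.

Definition path_tree n (G : graph n) (p : seq 'I_n) : graph n :=
  [set e in G | [exists u in e, exists v in e, index v p == (index u p).+1]].

Lemma adj_path_tree n (G : graph n) p u v :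
  adj (path_tree G p) u v =
  adj G u v && ((index v p == (index u p).+1) || (index u p == (index v p).+1)).
Proof.
rewrite /adj /= inE andbA; congr andb; apply/exists_inP/orP.
  case=> u' /set2P u'E /exists_inP[v' /set2P v'E].
  case: u'E v'E => -> [] -> rank_uv; [|by left|by right|]; exfalso; lia.
case=> rank_uv.
  by exists u; rewrite ?set21 //; apply/exists_inP; exists v; rewrite ?set22.
by exists v; rewrite ?set22 //; apply/exists_inP; exists u; rewrite ?set21.
Qed.

Lemma spanning_tree_path n (G : graph n) p :
  uniq p -> (forall v, v \in p) -> sorted (adj G) p ->
  spanning_tree (path_tree G p).
Proof.
move=> Up all_p sorted_p; split=> [u v|c size_c cycle_c].
  apply: (connect_sorted _ _ (all_p u) (all_p v)).
    exact/sym_connect_sym/adj_sym.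
  apply/(sortedP u) => i lt_i.
  rewrite adj_path_tree (sortedP u sorted_p) //.
  by rewrite !index_uniq ?eqxx // ltnW.
have : size c <= 2; last by rewrite leqNgt size_c.
apply: (ucycle_ranked (rank := index^~ p)) cycle_c => [u v _ _ eq_rank|u v].
  by rewrite -(nth_index u (all_p u)) eq_rank nth_index.
by rewrite adj_path_tree => /andP[_ /orP[]/eqP]; [left|right].
Qed.

Lemma has_spanning_tree_of_hamiltonian_path n (G : graph n) :
  has_hamiltonian_path G -> has_spanning_tree G.
Proof.
case=> p [Up all_p sorted_p]; exists (path_tree G p).
  by apply/subsetP => e; rewrite inE => /andP[].
exact: spanning_tree_path.
Qed.

(* Imported only now because [classical_sets] shadows [cover] and [trivIset]. *)
From mathcomp Require Import all_order all_algebra.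
From mathcomp Require Import all_classical reals topology normedtype landau.
Import GRing.Theory Num.Theory.
Import numFieldNormedType.Exports.
Local Open Scope classical_set_scope.
Local Open Scope ring_scope.

Lemma threshold_Theta (R : realType) first (goal : forall n, graph n -> Prop)
    (bias : nat -> nat) (c n0 : nat) :
  (forall n, (n0 <= n)%N -> [/\ (bias n <= n./2)%N, (n <= c * bias n)%N &
     maker_wins (@goal n) first (bias n)]) ->
  exists2 b0 : nat -> nat,
    \forall n \near \oo, is_threshold_bias (@goal n) first (b0 n) &
    (fun n => (b0 n)%:R : R) =Theta_\oo (fun n => n%:R : R).
Proof.
move=> wins_bias; exists (fun n => threshold (@goal n) first).
  exists n0 => // n /wins_bias[_ _ wins_n].
  exact/is_threshold_bias_threshold/(maker_wins_leq _ wins_n).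
rewrite eqThetaE bigThetaE eqOmegaO; split; apply/eqO_exP.
  exists 1 => //; exists n0 => // n _; rewrite /= mul1r !ger0_norm // ler_nat.
  by apply: leq_trans (threshold_leq _ _) _; lia.
exists c.+1%:R; first by rewrite ltr0n.
exists n0 => // n /wins_bias[bias_le n_le wins_n] /=.
rewrite !ger0_norm // -natrM ler_nat (leq_trans n_le) // leq_mul //.
exact: leq_threshold wins_n.
Qed.

Theorem theorem1p5 (R : realType) (first : player) :
  (exists2 b0 : nat -> nat,
     \forall n \near \oo, is_threshold_bias (@has_triangle n) first (b0 n) &
     (fun n => (b0 n)%:R : R) =Theta_\oo (fun n => n%:R : R)) /\
  (exists2 b0 : nat -> nat,
     \forall n \near \oo, is_threshold_bias (@has_spanning_tree n) first (b0 n) &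
     (fun n => (b0 n)%:R : R) =Theta_\oo (fun n => n%:R : R)) /\
  (exists2 b0 : nat -> nat,
     \forall n \near \oo, is_threshold_bias (@has_hamiltonian_path n) first (b0 n) &
     (fun n => (b0 n)%:R : R) =Theta_\oo (fun n => n%:R : R)).
Proof.
have wins_path n : (4000 <= n)%N -> [/\ (n %/ 4000 <= n./2)%N,
    (n <= 2 * 4000 * (n %/ 4000))%N &
    maker_wins (@has_hamiltonian_path n) first (n %/ 4000)].
  by move=> n_ge; split; [lia|lia|apply: maker_wins_hamiltonian_path; lia].
split; last split.
- apply: (@threshold_Theta _ _ _ half 3 13) => n n_ge.
  by split; [|lia|exact: maker_wins_triangle].
- apply: (@threshold_Theta _ _ _ _ _ 4000) => n /wins_path[bias_le n_le wins_n].
  split; [exact: bias_le|exact: n_le|apply: maker_wins_imply _ wins_n].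
  exact: has_spanning_tree_of_hamiltonian_path.
exact: threshold_Theta wins_path.
Qed.
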